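(* Let $A$ be an abelian group. A gauge class of a solution of the pentagon equation $\omega\in H^3(A,\mathbb{R}/\mathbb{Z})$ admits a solution of the hexagon equation if and only if $\tau_3(\omega)=0$ in $H^3(\mathrm{Tot}^*(D^{*,*}(A,\mathbb{R}/\mathbb{Z})))$.
   Context: Groups are written additively; $\mathrm{U}(1)$ is identified with $\mathbb{R}/\mathbb{Z}$, on which $A$ acts trivially. A solution of the pentagon equation for $A$ is a (normalized) 3-cocycle $\omega\in Z^3(A,\mathbb{R}/\mathbb{Z})$ in the inhomogeneous complex, and gauge classes of solutions are elements of the group cohomology $H^3(A,\mathbb{R}/\mathbb{Z})$. A solution of the hexagon equation for $\omega$ is a map $c:A\times A\to\mathbb{R}/\mathbb{Z}$ with $c(a,0)=c(0,a)=0$ and, for all $a,b,d\in A$, $$\omega(b,a,d)-\omega(a,b,d)-\omega(b,d,a)=c(a,b+d)-c(a,b)-c(a,d),$$ $$\omega(a,b,d)+\omega(d,a,b)-\omega(a,d,b)=c(a+b,d)-c(a,d)-c(b,d).$$ A gauge class admits a solution of the hexagon equation if a cocycle representing it does (this does not depend on the representative). Double complex, with $N=\mathbb{R}/\mathbb{Z}$: $D^{p,q}(A,N)$ is the group of all maps $A^p\times A^q\to N$ (values written $F(g_1,\dots,g_p\|k_1,\dots,k_q)$) for $p,q>0$, and $0$ if $p=0$ or $q=0$. $\delta_h:D^{p,q}\to D^{p+1,q}$ and $\delta_v:D^{p,q}\to D^{p,q+1}$ are the standard inhomogeneous group cohomology differentials (trivial action) in the first $p$ and last $q$ variables respectively;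 $\mathrm{Tot}^*$ is the total complex, with differential $\delta_h+(-1)^p\delta_v$ on $D^{p,q}$. Thus $\mathrm{Tot}^2=D^{1,1}$ and $\mathrm{Tot}^3=D^{1,2}\oplus D^{2,1}$. $\tau_3:H^3(A,N)\to H^3(\mathrm{Tot}^*(D^{*,*}(A,N)))$ sends the class of $\omega$ to the class of $(\alpha_\omega,\beta_\omega)\in D^{1,2}\oplus D^{2,1}$, where $\alpha_\omega(x\|y,z)=\omega(x,y,z)-\omega(y,x,z)+\omega(y,z,x)$ and $\beta_\omega(x,y\|z)=\omega(x,y,z)-\omega(x,z,y)+\omega(z,x,y)$. *)

(* Defs.v *)
From HB Require Import structures.
From mathcomp Require Import all_boot all_order all_algebra.
From mathcomp Require Import generic_quotient ring_quotient.
From mathcomp Require Import boolp functions reals.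

Set Implicit Arguments.
Unset Strict Implicit.
Unset Printing Implicit Defensive.

Import Order.TTheory GRing.Theory Num.Theory.
Local Open Scope ring_scope.
Local Open Scope quotient_scope.

(* [Num.int_num_subdef] is the predicate underlying the qualifier [Num.int]. *)
Definition RmodZ (R : realType) : zmodType :=
  Quotient.quot (Num.int_num_subdef : {pred R}).

(* A decision procedure for integer linear identities in a zmodType, where
   [ring] does not apply. *)
Inductive zexp := ZVar of nat | ZAdd of zexp & zexp | ZOpp of zexp | ZZero.

Section ZmodReflection.
Variables (N : zmodType) (env : seq N).

Fixpoint zeval e : N :=
  match e with
  | ZVar i => env`_i
  | ZAdd e1 e2 => zeval e1 + zeval e2
  | ZOpp e1 => - zeval e1
  | ZZero => 0
  end.

Fixpoint zcoef (e : zexp) (j : nat) : int :=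
  match e with
  | ZVar i => (i == j)%:Z
  | ZAdd e1 e2 => zcoef e1 j + zcoef e2 j
  | ZOpp e1 => - zcoef e1 j
  | ZZero => 0
  end.

Lemma zevalE e : zeval e = \sum_(j < size env) env`_j *~ zcoef e j.
Proof.
elim: e => [i|e1 IH1 e2 IH2|e1 IH|] /=.
- case: (ltnP i (size env)) => [lt_i|le_i].
    rewrite (bigD1 (Ordinal lt_i)) //= eqxx mulr1z big1 ?addr0 // => j.
    by rewrite eq_sym -val_eqE /= => /negPf->; rewrite mulr0z.
  rewrite nth_default // big1 // => j _.
  by rewrite gtn_eqF ?mulr0z // (leq_trans (ltn_ord j)).
- by rewrite IH1 IH2 -big_split; apply: eq_bigr => j _; rewrite mulrzDr.
- by rewrite IH -sumrN; apply: eq_bigr => j _; rewrite mulrNz.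
- by rewrite big1 // => j _; rewrite mulr0z.
Qed.

Lemma zeval_eq e1 e2 :
  all (fun j => zcoef e1 j == zcoef e2 j) (iota 0 (size env)) ->
  zeval e1 = zeval e2.
Proof.
move=> /allP eq_e; rewrite !zevalE; apply: eq_bigr => j _; congr (_ *~ _).
by apply/eqP/eq_e; rewrite mem_iota add0n ltn_ord.
Qed.

End ZmodReflection.

Ltac zmod_index x env :=
  lazymatch env with
  | x :: _ => constr:(0%N)
  | _ :: ?env' => let i := zmod_index x env' in constr:(i.+1)
  end.
Ltac zmod_env e env :=
  lazymatch e with
  | (?a + ?b)%R => let env' := zmod_env a env in zmod_env b env'
  | (- ?a)%R => zmod_env a env
  | 0%R => env
  | ?x => match env with
          | _ => let i := zmod_index x env in env
          | _ => constr:(x :: env)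
          end
  end.
Ltac zmod_reify e env :=
  lazymatch e with
  | (?a + ?b)%R =>
      let a' := zmod_reify a env in let b' := zmod_reify b env in
      constr:(ZAdd a' b')
  | (- ?a)%R => let a' := zmod_reify a env in constr:(ZOpp a')
  | 0%R => constr:(ZZero)
  | ?x => let i := zmod_index x env in constr:(ZVar i)
  end.
Ltac zmod :=
  lazymatch goal with
  | |- @eq ?N ?a ?b =>
      let env := zmod_env a (@nil N) in
      let env := zmod_env b env in
      let a' := zmod_reify a env in let b' := zmod_reify b env in
      apply: (@zeval_eq _ env a' b'); vm_compute; reflexivity
  end.

(* The cohomology ker d2 / im d1 of C1 -d1-> C2 -d2-> C3. *)
Section Cohomology.
Variables (C1 C2 C3 : zmodType).
Variables (d1 : {additive C1 -> C2}) (d2 : {additive C2 -> C3}).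

Definition is_cocycle : {pred C2} := fun x => d2 x == 0.

Fact is_cocycle_zmod_closed : zmod_closed is_cocycle.
Proof.
split=> [|x y]; first by rewrite unfold_in /= raddf0.
by rewrite !unfold_in => /eqP dx /eqP dy; rewrite raddfB /= dx dy subr0.
Qed.
HB.instance Definition _ :=
  GRing.isZmodClosed.Build C2 is_cocycle is_cocycle_zmod_closed.

Record cocycle := Cocycle { cocycle_val : C2; _ : cocycle_val \in is_cocycle }.
HB.instance Definition _ := [isSub for cocycle_val].
HB.instance Definition _ := [Choice of cocycle by <:].
HB.instance Definition _ := [SubChoice_isSubZmodule of cocycle by <:].

Definition is_coboundary : {pred cocycle} :=
  fun z => `[< exists y : C1, d1 y = val z >].

Fact is_coboundary_zmod_closed : zmod_closed is_coboundary.
Proof.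
split=> [|x y]; first by apply/asboolP; exists 0; rewrite raddf0.
move=> /asboolP[u du] /asboolP[v dv]; apply/asboolP; exists (u - v).
by rewrite raddfB du dv.
Qed.
HB.instance Definition _ :=
  GRing.isZmodClosed.Build cocycle is_coboundary is_coboundary_zmod_closed.

Definition cohomology : zmodType := Quotient.quot is_coboundary.

Definition cohomology_class (z : cocycle) : cohomology := \pi_cohomology z.

Lemma cohomology_classP (z z' : cocycle) :
  cohomology_class z = cohomology_class z' <->
  exists y : C1, d1 y = val z - val z'.
Proof.
by split=> [/eqP|dz]; [|apply/eqP]; rewrite -Quotient.idealrBE;
  [move=> /asboolP|apply/asboolP].
Qed.

End Cohomology.

Section GroupCohomology.
Variables (A N : zmodType).

Definition cochain (n : nat) := n.-tuple A -> N.
HB.instance Definition _ n := GRing.Zmodule.on (cochain n).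

(* For g = (g_0, ..., g_n), [face 0 g] and [face n.+1 g] drop g_0 and g_n
   respectively, and for 0 < i < n.+1, [face i g] replaces g_(i-1), g_i by
   g_(i-1) + g_i. *)
Definition face n (i : nat) (g : n.+1.-tuple A) : n.-tuple A :=
  [tuple if (j.+1 < i)%N then g`_j
         else if j.+1 == i then g`_j + g`_j.+1
         else g`_j.+1 | j < n].

Definition diff n (F : cochain n) : cochain n.+1 :=
  fun g => \sum_(i < n.+2) F (face i g) *~ (-1) ^+ i.

Fact diff_zmod_morphism n : zmod_morphism (@diff n).
Proof.
move=> F G; apply/funext => g.
rewrite [RHS](_ : _ = diff F g - diff G g) // /diff -sumrB.
by apply: eq_bigr => i _; rewrite -mulrzBl.
Qed.
HB.instance Definition _ n :=
  GRing.isZmodMorphism.Build (cochain n) (cochain n.+1) (@diff n)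
    (@diff_zmod_morphism n).

Definition H3 : zmodType := cohomology (@diff 2) (@diff 3).

(* The groups D^{p,q} for p, q > 0; those with p = 0 or q = 0 are zero and
   accordingly do not occur in the total complex below. *)
Definition bicochain (p q : nat) := p.-tuple A -> q.-tuple A -> N.
HB.instance Definition _ p q := GRing.Zmodule.on (bicochain p q).

Definition diff_h p q (F : bicochain p q) : bicochain p.+1 q :=
  fun g k => diff (fun g' => F g' k) g.

Definition diff_v p q (F : bicochain p q) : bicochain p q.+1 :=
  fun g k => diff (F g) k.

Definition Tot2 : zmodType := bicochain 1 1.
Definition Tot3 : zmodType := (bicochain 1 2 * bicochain 2 1)%type.
Definition Tot4 : zmodType :=
  (bicochain 1 3 * (bicochain 2 2 * bicochain 3 1))%type.

(* The sign of [diff_v] on D^{p,q} is (-1)^p. *)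
Definition tot_diff2 (c : Tot2) : Tot3 := (- diff_v c, diff_h c).

Definition tot_diff3 (F : Tot3) : Tot4 :=
  (- diff_v F.1, (diff_h F.1 + diff_v F.2, diff_h F.2)).

Fact diff_h_zmod_morphism p q : zmod_morphism (@diff_h p q).
Proof.
move=> F G; apply/funext => g; apply/funext => k.
exact: (congr1 (fun f => f g) (raddfB (@diff p) (F^~ k) (G^~ k))).
Qed.
HB.instance Definition _ p q :=
  GRing.isZmodMorphism.Build (bicochain p q) (bicochain p.+1 q) (@diff_h p q)
    (@diff_h_zmod_morphism p q).

Fact diff_v_zmod_morphism p q : zmod_morphism (@diff_v p q).
Proof.
move=> F G; apply/funext => g.
exact: (raddfB (@diff q) (F g) (G g)).
Qed.
HB.instance Definition _ p q :=
  GRing.isZmodMorphism.Build (bicochain p q) (bicochain p q.+1) (@diff_v p q)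
    (@diff_v_zmod_morphism p q).

Fact tot_diff2_zmod_morphism : zmod_morphism tot_diff2.
Proof.
move=> F G; rewrite /tot_diff2 (raddfB (@diff_v 1 1)) (raddfB (@diff_h 1 1)).
by apply: (congr2 pair); rewrite //= opprD.
Qed.
HB.instance Definition _ :=
  GRing.isZmodMorphism.Build Tot2 Tot3 tot_diff2 tot_diff2_zmod_morphism.

Fact tot_diff3_zmod_morphism : zmod_morphism tot_diff3.
Proof.
move=> [F1 F2] [G1 G2]; rewrite /tot_diff3 /= (raddfB (@diff_v 1 2)) (raddfB (@diff_v 2 1)).
rewrite (raddfB (@diff_h 1 2)) (raddfB (@diff_h 2 1)).
apply: (congr2 pair); last apply: (congr2 pair) => //=.
  by rewrite /= opprD.
by rewrite opprD addrACA.
Qed.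
HB.instance Definition _ :=
  GRing.isZmodMorphism.Build Tot3 Tot4 tot_diff3 tot_diff3_zmod_morphism.

Definition H3Tot : zmodType := cohomology tot_diff2 tot_diff3.

Lemma diff1E (F : cochain 1) x y :
  diff F [tuple x; y] = F [tuple y] - F [tuple x + y] + F [tuple x].
Proof.
rewrite /diff !big_ord_recl big_ord0 /=.
rewrite !exprS !expr0 !mulr1 !mulN1r ?opprK !mulrN1z ?mulr1z addr0 !addrA.
by congr (F _ - F _ + F _);
  apply/eq_from_tnth => -[[|j] //= ?]; rewrite tnth_mktuple.
Qed.

Lemma diff2E (F : cochain 2) x y z :
  diff F [tuple x; y; z] =
  F [tuple y; z] - F [tuple x + y; z] + F [tuple x; y + z] - F [tuple x; y].
Proof.
rewrite /diff !big_ord_recl big_ord0 /=.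
rewrite !exprS !expr0 !mulr1 !mulN1r ?opprK !mulrN1z ?mulr1z addr0 !addrA.
by congr (F _ - F _ + F _ - F _);
  apply/eq_from_tnth => -[[|[|j]] //= ?]; rewrite tnth_mktuple.
Qed.

Lemma diff3E (F : cochain 3) x y z t :
  diff F [tuple x; y; z; t] =
  F [tuple y; z; t] - F [tuple x + y; z; t] + F [tuple x; y + z; t]
  - F [tuple x; y; z + t] + F [tuple x; y; z].
Proof.
rewrite /diff !big_ord_recl big_ord0 /=.
rewrite !exprS !expr0 !mulr1 !mulN1r ?opprK !mulrN1z ?mulr1z addr0 !addrA.
by congr (F _ - F _ + F _ - F _ + F _);
  apply/eq_from_tnth => -[[|[|[|j]]] //= ?]; rewrite tnth_mktuple.
Qed.

Definition tau3_alpha (w : cochain 3) : bicochain 1 2 := fun g k =>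
  let x := g`_0 in let y := k`_0 in let z := k`_1 in
  w [tuple x; y; z] - w [tuple y; x; z] + w [tuple y; z; x].

Definition tau3_beta (w : cochain 3) : bicochain 2 1 := fun g k =>
  let x := g`_0 in let y := g`_1 in let z := k`_0 in
  w [tuple x; y; z] - w [tuple x; z; y] + w [tuple z; x; y].

Lemma tuple1E (g : 1.-tuple A) : g = [tuple g`_0].
Proof. by apply/eq_from_tnth => -[[|j] //= ?]; rewrite (tnth_nth 0). Qed.

Lemma tuple2E (g : 2.-tuple A) : g = [tuple g`_0; g`_1].
Proof. by apply/eq_from_tnth => -[[|[|j]] //= ?]; rewrite !(tnth_nth 0). Qed.

Lemma tuple3E (g : 3.-tuple A) : g = [tuple g`_0; g`_1; g`_2].
Proof. by apply/eq_from_tnth => -[[|[|[|j]]] //= ?]; rewrite !(tnth_nth 0). Qed.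

Fact tau3_cocycle_subproof (w : cocycle (@diff 3)) :
  (tau3_alpha (val w), tau3_beta (val w)) \in is_cocycle tot_diff3.
Proof.
case: w => w /= /eqP dw.
have {}dw x y z t : diff w [tuple x; y; z; t] = 0 by rewrite dw.
have AC (x y : A) : x + y = y + x by exact: addrC.
pose W x y z := w [tuple x; y; z].
have WE x y z : w [tuple x; y; z] = W x y z by [].
apply/eqP; rewrite /tot_diff3 /=.
congr (_, (_, _)); apply/funext => g; apply/funext => k.
- rewrite (tuple1E g) (tuple3E k) !fctE /diff_v diff2E /tau3_alpha /=.
  set x := g`_0; set y := k`_0; set z := k`_1; set t := k`_2.
  transitivity (diff w [tuple x; y; z; t] - diff w [tuple y; x; z; t]
    + diff w [tuple y; z; x; t] - diff w [tuple y; z; t; x]).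
    by rewrite !diff3E !WE (AC y x) (AC z x) (AC t x); zmod.
  by rewrite !dw !(subr0, addr0).
- rewrite (tuple2E g) (tuple2E k) !fctE /diff_v /diff_h !diff1E.
  rewrite /tau3_alpha /tau3_beta /=.
  set x := g`_0; set y := g`_1; set z := k`_0; set t := k`_1.
  transitivity (diff w [tuple x; y; z; t] - diff w [tuple x; z; y; t]
    + diff w [tuple x; z; t; y] + diff w [tuple z; x; y; t]
    - diff w [tuple z; x; t; y] + diff w [tuple z; t; x; y]).
    by rewrite !diff3E !WE (AC z y) (AC t y) (AC z x) (AC t x); zmod.
  by rewrite !dw !(subr0, addr0).
- rewrite (tuple3E g) (tuple1E k) /diff_h diff2E /tau3_beta /=.
  set x := g`_0; set y := g`_1; set z := g`_2; set t := k`_0.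
  transitivity (diff w [tuple x; y; z; t] - diff w [tuple x; y; t; z]
    + diff w [tuple x; t; y; z] - diff w [tuple t; x; y; z]).
    by rewrite !diff3E !WE (AC t x) (AC t y) (AC t z); zmod.
  by rewrite !dw !(subr0, addr0).
Qed.

Definition tau3_cocycle (w : cocycle (@diff 3)) : cocycle tot_diff3 :=
  Cocycle (tau3_cocycle_subproof w).

Definition H3_class (w : cocycle (@diff 3)) : H3 :=
  cohomology_class (@diff 2) w.

(* By [tau3_class] below, the choice of representative is irrelevant. *)
Definition tau3 (u : H3) : H3Tot :=
  cohomology_class tot_diff2 (tau3_cocycle (repr u)).

Lemma tau3_class (w : cocycle (@diff 3)) :
  tau3 (H3_class w) = cohomology_class tot_diff2 (tau3_cocycle w).
Proof.
apply/cohomology_classP.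
have /cohomology_classP[h dh] :
  cohomology_class (@diff 2) (repr (H3_class w)) = cohomology_class _ w.
  by rewrite /cohomology_class reprK.
have {}dh x y z : val (repr (H3_class w)) [tuple x; y; z] =
    diff h [tuple x; y; z] + val w [tuple x; y; z].
  by rewrite dh !fctE subrK.
have AC (x y : A) : x + y = y + x by exact: addrC.
pose W x y z := val w [tuple x; y; z].
have WE x y z : val w [tuple x; y; z] = W x y z by [].
pose H x y := h [tuple x; y].
have HE x y : h [tuple x; y] = H x y by [].
exists (fun g k => h [tuple g`_0; k`_0] - h [tuple k`_0; g`_0]).
rewrite /tot_diff2 /=; congr (_, _); apply/funext => g; apply/funext => k.
- rewrite [RHS](_ : _ = tau3_alpha (val (repr (H3_class w))) g k
    - tau3_alpha (val w) g k) //.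
  rewrite (tuple1E g) (tuple2E k) /tau3_alpha !fctE /diff_v diff1E /= !dh.
  rewrite !diff2E.
  set x := g`_0; set y := k`_0; set z := k`_1.
  by rewrite !HE !WE ?(AC y x) (AC z x); zmod.
- rewrite [RHS](_ : _ = tau3_beta (val (repr (H3_class w))) g k
    - tau3_beta (val w) g k) //.
  rewrite (tuple2E g) (tuple1E k) /tau3_beta /diff_h diff1E /= !dh.
  rewrite !diff2E.
  set x := g`_0; set y := g`_1; set z := k`_0.
  by rewrite !HE !WE (AC z x) (AC z y); zmod.
Qed.

Definition normalized3 (w : cochain 3) : Prop :=
  forall x y : A, [/\ w [tuple 0; x; y] = 0, w [tuple x; 0; y] = 0
                    & w [tuple x; y; 0] = 0].

Definition pentagon_solution (w : cocycle (@diff 3)) : Prop :=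
  normalized3 (val w).

Definition hexagon_solution (w : cochain 3) (c : A -> A -> N) : Prop :=
  [/\ forall a, c a 0 = 0 /\ c 0 a = 0,
      forall a b d, w [tuple b; a; d] - w [tuple a; b; d] - w [tuple b; d; a]
                    = c a (b + d) - c a b - c a d
    & forall a b d, w [tuple a; b; d] + w [tuple d; a; b] - w [tuple a; d; b]
                    = c (a + b) d - c a d - c b d].

Definition admits_hexagon_solution (u : H3) : Prop :=
  exists w : cocycle (@diff 3),
    [/\ pentagon_solution w, H3_class w = u
      & exists c : A -> A -> N, hexagon_solution (val w) c].

End GroupCohomology.

(* Main.v *)
(** Multiplying by [-1], a solution [c] of the hexagon equation for [w] is a
    cochain in [D^{1,1}] with total coboundary [(alpha_w, beta_w)], except for
    the condition [c(a,0) = c(0,a) = 0]. That condition is automatic when [w]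
    is normalized, since then [alpha_w(a||0,0) = beta_w(0,0||a) = 0]. It
    remains to normalize a representative: the 3-cocycle [w] minus the
    coboundary of [h(x,y) = w(0,0,y) - w(x,0,0)] is normalized. *)
Require Import Defs.
From mathcomp Require Import all_boot all_algebra reals.
From mathcomp Require Import generic_quotient ring_quotient boolp functions.
Import GRing.Theory.
Local Open Scope ring_scope.

Lemma cohomology_class_eq0 (C1 C2 C3 : zmodType) (d1 : {additive C1 -> C2})
    (d2 : {additive C2 -> C3}) (z : cocycle d2) :
  cohomology_class d1 z = 0 <-> exists y, d1 y = val z.
Proof.
have -> : 0 = cohomology_class d1 (0 : cocycle d2) by exact/esym/pi_zeror.
by rewrite cohomology_classP subr0.
Qed.

Section Normalization.
Variables A N : zmodType.

Lemma tuple4E (g : 4.-tuple A) : g = [tuple g`_0; g`_1; g`_2; g`_3].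
Proof.
by apply/eq_from_tnth => -[[|[|[|[|j]]]] //= ?]; rewrite !(tnth_nth 0).
Qed.

Lemma diff_diff2 (h : cochain A N 2) : diff (diff h) = 0.
Proof.
apply/funext => g; rewrite (tuple4E g) diff3E !diff2E !addrA.
pose H x y := h [tuple x; y].
have HE x y : h [tuple x; y] = H x y by [].
by rewrite !HE [RHS](_ : _ = 0) //; zmod.
Qed.

Lemma normalized_representative (w : cocycle (@diff A N 3)) :
  exists2 w' : cocycle (@diff A N 3),
    pentagon_solution w' & H3_class w' = H3_class w.
Proof.
pose W x y z := val w [tuple x; y; z].
have WE x y z : val w [tuple x; y; z] = W x y z by [].
have dw x y z t :
    W y z t - W (x + y) z t + W x (y + z) t - W x y (z + t) + W x y z = 0.
  by have /eqP dw0 := valP w; rewrite -!WE -diff3E dw0.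
(* In each of the next three cocycle identities, equal terms cancel, so every value of [W] with a
   zero argument reduces to the one-variable functions [W 0 0 _] and [W _ 0 0]. *)
have w0yz y z : W 0 y z = W 0 0 (y + z) - W 0 0 y.
  apply/eqP; rewrite -subr_eq0 -[X in _ == X](dw 0 0 y z) !add0r; apply/eqP.
  by zmod.
have wx0z x z : W x 0 z = W 0 0 z + W x 0 0.
  apply/eqP; rewrite eq_sym -subr_eq0 -[X in _ == X](dw x 0 0 z) !(add0r, addr0).
  by apply/eqP; zmod.
have wxy0 x y : W x y 0 = W (x + y) 0 0 - W y 0 0.
  apply/eqP; rewrite -subr_eq0 -[X in _ == X](dw x y 0 0) !addr0; apply/eqP.
  by zmod.
have w000 : W 0 0 0 = 0 by rewrite w0yz addr0 subrr.
(* By [w0yz] and [wxy0], the coboundary of [h] at [(x,y,z)] is [W x y 0 + W 0 y z], which agrees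
   with [W x y z] as soon as one argument is zero. *)
pose h : cochain A N 2 := fun g => W 0 0 g`_1 - W g`_0 0 0.
have cocycle_w' : val w - diff h \in is_cocycle (@diff A N 3).
  rewrite unfold_in (raddfB (@diff A N 3)) /= diff_diff2 subr0; exact: valP w.
exists (Cocycle cocycle_w').
  have w'E x y z : (val w - diff h) [tuple x; y; z] =
      W x y z - (W 0 0 z - W y 0 0 - (W 0 0 z - W (x + y) 0 0)
        + (W 0 0 (y + z) - W x 0 0) - (W 0 0 y - W x 0 0)).
    by rewrite !fctE diff2E.
  move=> x y; split; apply: (etrans (w'E _ _ _)); rewrite !(add0r, addr0) ?w000.
  - by rewrite w0yz; zmod.
  - by rewrite wx0z; zmod.
  - by rewrite wxy0; zmod.
apply/cohomology_classP; exists (- h).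
by rewrite raddfN /= addrC addKr.
Qed.

Lemma pentagon_hexagonP (w : cocycle (@diff A N 3)) :
  pentagon_solution w ->
  (exists c, hexagon_solution (val w) c) <-> tau3 (H3_class w) = 0.
Proof.
move=> w_norm; rewrite tau3_class.
rewrite cohomology_class_eq0 /=; pose W x y z := cocycle_val w [tuple x; y; z].
have WE x y z : cocycle_val w [tuple x; y; z] = W x y z by [].
(* The cochain formulas carry syntactically distinct instances of the addition
   of [A]; folding them all into [S] makes them identical atoms for [zmod]. *)
pose S (x y : A) := x + y.
have SE x y : x + y = S x y by [].
split=> [[c [_ c_alpha c_beta]]|[y [alphaE betaE]]].
  (* The left sides of the hexagon equations are [- alpha_w] and [beta_w]; the sign of [diff_v] in
     [tot_diff2] absorbs this discrepancy. *)
  exists (fun g k => - c g`_0 k`_0).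
  congr pair; apply/funext => g; apply/funext => k.
    rewrite (tuple1E g) (tuple2E k) !fctE /diff_v diff1E /tau3_alpha /=.
    set a := g`_0; set b := k`_0; set d := k`_1.
    transitivity (- (c a (b + d) - c a b - c a d)); first by rewrite !SE; zmod.
    by rewrite -c_alpha !WE; zmod.
  rewrite (tuple2E g) (tuple1E k) /diff_h diff1E /tau3_beta /=.
  set a := g`_0; set b := g`_1; set d := k`_0.
  transitivity (c (a + b) d - c a d - c b d); first by rewrite !SE; zmod.
  by rewrite -c_beta !WE; zmod.
pose Y a b := y [tuple a] [tuple b].
have YE a b : y [tuple a] [tuple b] = Y a b by [].
pose c a b := - Y a b.
have c_alpha a b d : W b a d - W a b d - W b d a = c a (b + d) - c a b - c a d.
  have /= := congr1 (fun F => - F [tuple a] [tuple b; d]) alphaE.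
  rewrite !fctE /diff_v diff1E /tau3_alpha /= !WE /c => E.
  transitivity (- (W a b d - W b a d + W b d a)); first by zmod.
  by rewrite -E !YE !SE; zmod.
have c_beta a b d : W a b d + W d a b - W a d b = c (a + b) d - c a d - c b d.
  have /= := congr1 (fun F => F [tuple a; b] [tuple d]) betaE.
  rewrite /diff_h diff1E /tau3_beta /= !WE /c => E.
  transitivity (W a b d - W a d b + W d a b); first by zmod.
  by rewrite -E !YE !SE; zmod.
exists c; split=> // a.
have [w0a0 wa00 _] : [/\ W 0 a 0 = 0, W a 0 0 = 0 & W a 0 0 = 0] := w_norm a 0.
have [w00a _ _] : [/\ W 0 0 a = 0, W 0 0 a = 0 & W 0 a 0 = 0] := w_norm 0 a.
(* At [b = d = 0] the right side of [c_alpha] collapses to [- c a 0]; likewise [c_beta] at [(0,0,a)]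
   gives [- c 0 a]. *)
split; apply/eqP; rewrite -oppr_eq0; apply/eqP.
  transitivity (c a (0 + 0) - c a 0 - c a 0); first by rewrite addr0; zmod.
  by rewrite -c_alpha w0a0 wa00 w00a !subr0.
transitivity (c (0 + 0) a - c 0 a - c 0 a); first by rewrite addr0; zmod.
by rewrite -c_beta w00a wa00 w0a0 addr0 subr0.
Qed.

End Normalization.

Theorem corollary4p6 (R : realType) (A : zmodType) (u : H3 A (RmodZ R)) :
  admits_hexagon_solution u <-> tau3 u = 0.
Proof.
split=> [[w [w_norm <- hex]]|]; first exact/pentagon_hexagonP.
(* The arbitrary representative [repr u] is traded for a normalized one of the same class. *)
have -> : u = H3_class (repr u) by rewrite /H3_class /cohomology_class reprK.
have [w w_norm <-] := normalized_representative _ _ (repr u).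
by move=> tau0; exists w; split=> //; apply/pentagon_hexagonP.
Qed.
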